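(* Let $S\subseteq[a]\times[b]$ be nonempty and suppose that the bipartite graph $\mathcal{G}_S$ is a forest but is not a forest of stars. Then the model corresponding to the Lawrence lift of $\mathcal{A}_S$ has ML-degree $1$, but the modified Lawrence lift $\Lambda'(\mathcal{A}_S)$ is not a coordinate toric fiber product.
   Context: **Matrices and graph.** $\mathcal{A}_S$ is the $0/1$ matrix with columns indexed by $S$, consisting of a block $\mathcal{A}$ with rows indexed by $[a]$ and a block $\mathcal{B}$ with rows indexed by $[b]$; the column of $(i,j)$ has exactly one $1$ in each block, in rows $i$ and $j$. $\mathcal{G}_S$ is the bipartite graph on $[a]\sqcup[b]$ with edge set $S$. A star is a tree with one central node and $k$ leaves; a forest of stars is a graph each of whose connected components is a star. **Lawrence lifts.** With $n=\#S$, and $I_n$ the $n\times n$ identity matrix, the Lawrence lift of $\mathcal{A}_S$ is $\begin{pmatrix} \mathcal{A}_S & 0 \\ 0 & \mathcal{A}_S \\ I_n & I_n \end{pmatrix}$. The modified Lawrence lift $\Lambda'(\mathcal{A}_S)$ is obtained by rearranging its rows into three blocks $\begin{pmatrix} \mathcal{A} & 0 \\ 0 & \mathcal{A} \end{pmatrix}$, $\begin{pmatrix} \mathcal{B} & 0 \\ 0 & \mathcal{B} \end{pmatrix}$, $\begin{pmatrix} I_n & I_n \end{pmatrix}$. The two define the same log-linear model, which is the $3$-way quasi-independence model of $S'=\{(a_t,b_t,t): t\in[n]\}\cup\{(a_t+a,b_t+b,t): t\in[n]\}$, where $S=\{(a_1,b_1),\dots,(a_n,b_n)\}$. **ML-degree.**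 The log-linear model of an integer matrix $M$ (with the all-ones vector in its row span) is the set of positive probability vectors $p$ with $\log p\in\mathrm{rowspan}(M)$. Its ML-degree is the number of complex critical points, counted with multiplicity, of $\sum_s u_s\log p_s$, for generic data $u$, on the part of its complex Zariski closure with $\sum_s p_s=1$ and all $p_s\neq0$. Equivalently, it is the number of such points with $Mu=u_+Mp$, $u_+=\sum_s u_s$. **Coordinate toric fiber product (cTFP).** A set $T$ of triples (equivalently, the associated three-block matrix) is a cTFP along coordinate $j\in\{1,2,3\}$ if, with $\{p,q\}=\{1,2,3\}\setminus\{j\}$, whenever $s,t\in T$ have the same $j$th coordinate, the triple with $j$th coordinate $s_j=t_j$, $p$th coordinate $s_p$ and $q$th coordinate $t_q$ is also in $T$. $T$ is a cTFP if it is one along at least one coordinate. *)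

(* Defs.v *)
From HB Require Import structures.
From mathcomp Require Import all_boot all_order all_algebra.
From mathcomp Require Import complex reals exp mpoly.
Set Implicit Arguments.
Unset Strict Implicit.
Unset Printing Implicit Defensive.
Import Order.TTheory GRing.Theory Num.Theory.
Local Open Scope ring_scope.
Local Open Scope complex_scope.

(** ** Graphs *)

Definition bip_graph (a b : nat) (S : {set 'I_a * 'I_b}) : rel ('I_a + 'I_b) :=
  fun x y => match x, y with
             | inl i, inr j => (i, j) \in S
             | inr j, inl i => (i, j) \in S
             | _, _ => false
             end.

(* An edge traversed back and forth is a [ucycle] of size 2, hence the bound. *)
Definition is_forest (T : finType) (e : rel T) : Prop :=
  forall c : seq T, (2 < size c)%N -> ~ ucycle e c.

(* The graph induced on [A] is a star K_{1,k} with centre [c]; k = 0, that is,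
   an isolated vertex, is allowed. *)
Definition is_star (T : finType) (e : rel T) (A : {set T}) : Prop :=
  exists2 c, c \in A &
    {in A &, forall x y, e x y = (x == c) (+) (y == c)}.

Definition is_forest_of_stars (T : finType) (e : rel T) : Prop :=
  forall x : T, is_star e [set y | connect e x y].

(** ** Matrices *)

(* The t-th column is the column of [enum_val t], the t-th element of [S]. *)
Definition quasi_indep_mx (a b : nat) (S : {set 'I_a * 'I_b}) :
    'M[int]_(a + b, #|S|) :=
  col_mx (\matrix_(i, t) ((enum_val t).1 == i)%:R)
         (\matrix_(j, t) ((enum_val t).2 == j)%:R).

Definition lawrence (m n : nat) (A : 'M[int]_(m, n)) :
    'M[int]_(m + m + n, n + n) :=
  col_mx (block_mx A 0 0 A) (row_mx 1%:M 1%:M).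

Definition modified_lawrence (m1 m2 n : nat) (A : 'M[int]_(m1 + m2, n)) :
    'M[int]_((m1 + m1) + (m2 + m2) + n, n + n) :=
  col_mx (col_mx (block_mx (usubmx A) 0 0 (usubmx A))
                 (block_mx (dsubmx A) 0 0 (dsubmx A)))
         (row_mx 1%:M 1%:M).

(** ** Coordinate toric fiber products *)

Section CoordinateTFP.
Variables X1 X2 X3 : finType.
Implicit Type T : {set X1 * X2 * X3}.

(* In each case the other choice of the pair (p, q) amounts to exchanging the
   two given triples. *)
Definition cTFP_along1 T : Prop := forall i j k j' k',
  (i, j, k) \in T -> (i, j', k') \in T -> (i, j, k') \in T.

Definition cTFP_along2 T : Prop := forall i j k i' k',
  (i, j, k) \in T -> (i', j, k') \in T -> (i, j, k') \in T.

Definition cTFP_along3 T : Prop := forall i j k i' j',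
  (i, j, k) \in T -> (i', j', k) \in T -> (i, j', k) \in T.

Definition cTFP T : Prop := [\/ cTFP_along1 T, cTFP_along2 T | cTFP_along3 T].

End CoordinateTFP.

(* The set of triples encoded by a 0/1 matrix with three blocks of rows: each
   column gives the triple of the positions of its 1s in the blocks. *)
Definition triples_of_mx (r1 r2 r3 n : nat) (M : 'M[int]_(r1 + r2 + r3, n)) :
    {set 'I_r1 * 'I_r2 * 'I_r3} :=
  [set x | [exists t, [&& usubmx (usubmx M) x.1.1 t == 1,
                          dsubmx (usubmx M) x.1.2 t == 1 &
                          dsubmx M x.2 t == 1]]].

Definition cTFP_mx (r1 r2 r3 n : nat) (M : 'M[int]_(r1 + r2 + r3, n)) : Prop :=
  cTFP (triples_of_mx M).

(** ** Log-linear models and their ML-degree *)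

Definition log_linear_model (R : realType) (m N : nat) (M : 'M[int]_(m, N))
    (p : 'rV[R]_N) : Prop :=
  [/\ forall s, 0 < p 0 s, \sum_s p 0 s = 1 &
      (map_mx (@ln R) p <= map_mx intr M)%MS].

Section MLDegree.
Variables (R : realType) (N : nat).
Local Notation C := R[i].
Local Notation poly := {mpoly C[N]}.
Implicit Types (X : 'rV[C]_N -> Prop) (J : poly -> Prop).
Implicit Types (u p v : 'rV[C]_N) (D : 'I_N -> poly).

Definition vanishing_ideal X (f : poly) : Prop :=
  forall p, X p -> f.@[p 0] = 0.

Definition zariski_closure X p : Prop :=
  forall f, vanishing_ideal X f -> f.@[p 0] = 0.

Definition complex_points (Y : 'rV[R]_N -> Prop) p : Prop :=
  exists2 q, Y q & p = map_mx (real_complex R) q.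

Definition likelihood_variety (m : nat) (M : 'M[int]_(m, N)) p : Prop :=
  [/\ zariski_closure (complex_points (log_linear_model M)) p,
      \sum_s p 0 s = 1 & forall s, p 0 s != 0].

Definition tangent_vector X p v : Prop :=
  forall f, vanishing_ideal X f -> \sum_s v 0 s * (f^`M(s)).@[p 0] = 0.

(* [p] is a critical point on [X] of the log-likelihood \sum_s u_s log p_s,
   whose partial derivatives are u_s / p_s.  When the all-ones vector is in the
   row span of M, the likelihood variety of M is smooth, being isomorphic to
   the complement of a hypersurface in a torus, so that its tangent spaces are
   the Zariski tangent spaces. *)
Definition critical_point X u p : Prop :=
  X p /\ forall v, tangent_vector X p v -> \sum_s u 0 s / p 0 s * v 0 s = 0.

(* The multiplicity of a critical point is the dimension of its local Jacobian
   algebra, the quotient of the local ring of [X] at [p] by the derivatives of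
   the log-likelihood along all the derivations of this ring. *)

(* The polynomial vector fields \sum_s D_s d/dx_s that preserve the ideal of
   [X], and thus induce derivations of the coordinate ring. *)
Definition tangent_field X D : Prop :=
  forall f, vanishing_ideal X f ->
    vanishing_ideal X (\sum_s D s * f^`M(s)).

(* The derivative of the log-likelihood along [D], multiplied by
   \prod_s x_s, which is a unit at the points considered. *)
Definition score u D : poly :=
  \sum_s u 0 s *: (D s * \prod_(t | t != s) 'X_t).

(* This is an ideal, as tangent fields form a module over the polynomials. *)
Definition critical_ideal X u (f : poly) : Prop :=
  exists2 D, tangent_field X D & vanishing_ideal X (f - score u D).

(* The kernel of the map from polynomials to the localization at [p] of their
   quotient by [J].  When [p] is an isolated zero of [J] this map is onto. *)
Definition local_ideal J p (f : poly) : Prop :=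
  exists2 g : poly, g.@[p 0] != 0 & J (g * f).

(* The quotient by [J] has a basis of [k] elements. *)
Definition codimension J (k : nat) : Prop :=
  exists b : 'I_k -> poly, forall f : poly,
    exists! c : 'rV[C]_k, J (f - \sum_i c 0 i *: b i).

Definition multiplicity X u p (k : nat) : Prop :=
  codimension (local_ideal (critical_ideal X u) p) k.

(* Data are generic when they avoid the zeros of some nonzero polynomial [h]. *)
Definition ML_degree (m : nat) (M : 'M[int]_(m, N)) (d : nat) : Prop :=
  let X := likelihood_variety M in
  exists2 h : poly, h != 0 &
  forall u, h.@[u 0] != 0 ->
  exists (pts : seq 'rV[C]_N) (mult : 'rV[C]_N -> nat),
    [/\ uniq pts,
        forall p, p \in pts <-> critical_point X u p,
        forall p, p \in pts -> multiplicity X u p (mult p) &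
        (\sum_(p <- pts) mult p)%N = d].

End MLDegree.

Arguments ML_degree R {N m} M d.

(* Main.v *)
Require Import Defs.
From mathcomp Require Import all_boot all_order all_algebra.
From mathcomp Require Import complex reals mpoly.
Set Implicit Arguments.
Unset Strict Implicit.
Unset Printing Implicit Defensive.
Import Order.TTheory GRing.Theory Num.Theory.
Local Open Scope ring_scope.
Local Open Scope complex_scope.

(* The columns of A_S are linearly independent when the graph is a forest, so
   the row span of the Lawrence lift is the whole space and its model is the
   open simplex.  There the likelihood equations have the unique solution
   p = u / u_+, and it is reduced: modulo sum(x) = 1, the tangent field
   sum_s x_s (delta_si - x_i) d/dx_s has score u_i - u_+ x_i up to a unit.
   The triples of the modified lift are (i, j, t) and (i + a, j + b, t) for
   t = (i, j) in S.  A cTFP along the third coordinate would mix the two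
   copies, while one along the first or second coordinate forces all vertices
   of one side of the graph to have degree at most 1, which makes every
   component a star. *)

(** * Degree criteria for forests of stars *)

Lemma is_forest_of_stars_center (T : finType) (e : rel T) (c : T -> T) :
    (forall x y, e x y -> c x = c y) -> (forall x, connect e x (c x)) ->
    (forall x y, c x = c y -> e x y = (x == c x) (+) (y == c x)) ->
  is_forest_of_stars e.
Proof.
move=> c_edge c_conn c_star x.
(* Here [c x] plays the centre of the component of [x]: constant along edges, it is constant on
   components, so [c_star] applies to any two vertices of one. *)
have c_inv y : connect e x y -> c x = c y.
  case/connectP=> p + -> {y}; elim: p x => //= z p IHp x /andP[exz /IHp <-].
  exact: c_edge.
exists (c x); first by rewrite inE.
move=> y z; rewrite !inE => /c_inv cy /c_inv cz.
by rewrite c_star -cy -?cz.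
Qed.

Section BipartiteGraph.
Variables (a b : nat) (S : {set 'I_a * 'I_b}).
Local Notation G := (bip_graph S).

Lemma stars_of_left_degrees_le1 :
    (forall i j j', (i, j) \in S -> (i, j') \in S -> j = j') ->
  is_forest_of_stars G.
Proof.
move=> deg1.
(* Right vertices are centres, and a left vertex is attached to its only neighbour; an isolated one
   is its own centre. *)
pose c (x : 'I_a + 'I_b) : 'I_a + 'I_b := match x with
  | inl i => if [pick j | (i, j) \in S] is Some j then inr j else inl i
  | inr j => inr j
  end.
have cS i j : (i, j) \in S -> c (inl i) = inr j.
  move=> ij; rewrite /c; case: pickP => [j' ij'|/(_ j)]; last by rewrite ij.
  by rewrite (deg1 _ _ _ ij ij').
apply: (@is_forest_of_stars_center _ _ c).
- by move=> [i|j] [i'|j'] //= ij; [exact: cS | exact/esym/cS].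
- move=> [i|j]; last exact: connect0.
  rewrite /c; case: pickP => [j ij|_]; last exact: connect0.
  exact: connect1.
- have cl i x : c (inl i) = inl x -> x = i.
    by rewrite /c; case: pickP => // _ [].
  have cr i j : c (inl i) = inr j -> (i, j) \in S.
    by rewrite /c; case: pickP => // j' ij' [<-].
  move=> [i|j] [i'|j'].
  + move=> cE; have cE' := esym cE.
    case E: (c (inl i)) cE cE' => [x|x] cE cE' //=.
    by rewrite -(cl _ _ E) -(cl _ _ cE') eqxx.
  + by move=> /cr ij'; rewrite (cS _ _ ij') /= ij' eqxx.
  + by move=> /esym/cr ij'; rewrite /= ij' eqxx.
  + by case=> ->; rewrite /= eqxx.
Qed.

Lemma stars_of_right_degrees_le1 :
    (forall i i' j, (i, j) \in S -> (i', j) \in S -> i = i') ->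
  is_forest_of_stars G.
Proof.
move=> deg1.
pose c (x : 'I_a + 'I_b) : 'I_a + 'I_b := match x with
  | inr j => if [pick i | (i, j) \in S] is Some i then inl i else inr j
  | inl i => inl i
  end.
have cS i j : (i, j) \in S -> c (inr j) = inl i.
  move=> ij; rewrite /c; case: pickP => [i' ij'|/(_ i)]; last by rewrite ij.
  by rewrite (deg1 _ _ _ ij ij').
apply: (@is_forest_of_stars_center _ _ c).
- by move=> [i|j] [i'|j'] //= ij; [exact/esym/cS | exact: cS].
- move=> [i|j]; first exact: connect0.
  rewrite /c; case: pickP => [i ij|_]; last exact: connect0.
  exact: connect1.
- have cl j x : c (inr j) = inr x -> x = j.
    by rewrite /c; case: pickP => // _ [].
  have cr i j : c (inr j) = inl i -> (i, j) \in S.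
    by rewrite /c; case: pickP => // i' ij' [<-].
  move=> [i|j] [i'|j'].
  + by case=> ->; rewrite /= eqxx.
  + by move=> /esym/cr ij'; rewrite /= ij' eqxx.
  + by move=> /cr ij'; rewrite (cS _ _ ij') /= ij' eqxx.
  + move=> cE; have cE' := esym cE.
    case E: (c (inr j)) cE cE' => [x|x] cE cE' //=.
    by rewrite -(cl _ _ E) -(cl _ _ cE') eqxx.
Qed.

(** * Triples of the modified Lawrence lift *)

Lemma mem_triples_modified_lawrence x :
  (x \in triples_of_mx (modified_lawrence (quasi_indep_mx S))) = [exists t : 'I_#|S|,
    (x.2 == t) && ((x.1 == (lshift a (enum_val t).1, lshift b (enum_val t).2))
      || (x.1 == (rshift a (enum_val t).1, rshift b (enum_val t).2)))].
Proof.
have nat_eq1 (b0 : bool) : ((b0%:R : int) == 1) = b0 by case: b0.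
rewrite inE; case: x => [[i j] k] /=.
rewrite /modified_lawrence /quasi_indep_mx !col_mxKu !col_mxKd.
apply/existsP/existsP => -[t]; last first.
  case/andP=> /eqP-> /orP[] /eqP[-> ->].
    by exists (lshift _ t); rewrite !block_mxEul row_mxEl !mxE !eqxx.
  by exists (rshift _ t); rewrite !block_mxEdr row_mxEr !mxE !eqxx.
(* Mixing the two copies hits a zero off-diagonal block, so only the two unmixed cases survive. *)
rewrite -(splitK t) -(splitK i) -(splitK j).
case: (split t) => t'; case: (split i) => i'; case: (split j) => j' /=.
all: rewrite ?block_mxEul ?block_mxEur ?block_mxEdl ?block_mxEdr.
all: rewrite ?row_mxEl ?row_mxEr !mxE ?nat_eq1.
all: case/and3P=> // /eqP<- /eqP<- /eqP->; exists t'.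
all: by rewrite !eqxx ?orbT.
Qed.

Lemma not_cTFP_modified_lawrence :
    S != set0 -> ~ is_forest_of_stars G ->
  ~ cTFP_mx (modified_lawrence (quasi_indep_mx S)).
Proof.
move=> S_neq0 not_stars.
set T := triples_of_mx (modified_lawrence (quasi_indep_mx S)).
have TE := mem_triples_modified_lawrence.
have Tl t : (lshift a (enum_val t).1, lshift b (enum_val t).2, t) \in T.
  by rewrite TE; apply/existsP; exists t; rewrite !eqxx.
have Tr t : (rshift a (enum_val t).1, rshift b (enum_val t).2, t) \in T.
  by rewrite TE; apply/existsP; exists t; rewrite !eqxx orbT.
have Tll i j t : (lshift a i, lshift b j, t) \in T -> enum_val t = (i, j).
  rewrite TE => /existsP[t' /andP[/eqP/= ->]].
  rewrite !xpair_eqE !eq_lshift !eq_lrshift orbF => /andP[/eqP-> /eqP->].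
  by case: (enum_val t').
have rankS x : x \in S -> {t : 'I_#|S| | enum_val t = x}.
  by move=> xS; exists (enum_rank_in xS x); rewrite enum_rankK_in.
case=> [T1|T2|T3].
(* For edges t = (i, j) and t' = (i, j') the product property puts (i, j, t') in [T]; as t'
   determines its edge, j = j'. *)
- apply/not_stars/stars_of_left_degrees_le1 => i j j' /rankS[t tE] /rankS[t' tE'].
  have := T1 _ _ _ _ _ (Tl t); rewrite tE /= => /(_ (lshift b j') t').
  have:= Tl t'; rewrite tE' => tl' /(_ tl') /Tll; rewrite tE'.
  by case.
- apply/not_stars/stars_of_right_degrees_le1 => i i' j /rankS[t tE] /rankS[t' tE'].
  have := T2 _ _ _ _ _ (Tl t); rewrite tE /= => /(_ (lshift a i') t').
  have:= Tl t'; rewrite tE' => tl' /(_ tl') /Tll; rewrite tE'.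
  by case.
- have /set0Pn[x /rankS[t _]] := S_neq0.
  have:= T3 _ _ _ _ _ (Tl t) (Tr t).
  rewrite TE => /existsP[t' /andP[_]].
  by rewrite !xpair_eqE eq_lrshift eq_rlshift andbF.
Qed.

(** * Linear independence of the columns for a forest *)

(** A path from i to j avoiding the edge, made simple, would close up with it into a cycle. That
    cycle has more than two vertices, since the only path of length 1 is the deleted edge. *)
Lemma forest_bridge i j :
    is_forest G -> (i, j) \in S ->
  ~~ connect (bip_graph (S :\ (i, j))) (inl i) (inr j).
Proof.
move=> S_forest ij; apply/connectP=> -[p].
case/shortenP=> q path_q uniq_q _ last_q.
apply: (S_forest (inl i :: q)).
  case: q path_q last_q {uniq_q} => [|x [|y q]] //= + E.
  by rewrite -E /= !inE eqxx.
rewrite /ucycle uniq_q /= rcons_path -last_q /= ij !andbT.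
by apply: sub_path path_q => -[x|x] [y|y] //=; rewrite inE => /andP[].
Qed.

(* Deleting the edge (i, j) from a forest separates i from j; the vector equal
   to 1 on the left vertices and to -1 on the right vertices of the component
   of i is orthogonal to every column but that of (i, j). *)
Lemma forest_quasi_indep_mx_linv :
  is_forest G -> exists L : 'M[int]_(#|S|, a + b), L *m quasi_indep_mx S = 1%:M.
Proof.
move=> S_forest.
pose W (t : 'I_#|S|) x := connect (bip_graph (S :\ enum_val t)) (inl (enum_val t).1) x.
exists (row_mx (\matrix_(t, i) (W t (inl i))%:R)
               (\matrix_(t, j) - (W t (inr j))%:R)).
apply/matrixP => t t'; rewrite mul_row_col !mxE.
rewrite (bigD1 (enum_val t').1) //= big1 ?addr0 => [|i]; last first.
  by rewrite !mxE eq_sym => /negPf->; rewrite mulr0.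
rewrite (bigD1 (enum_val t').2) //= big1 ?addr0 => [|j]; last first.
  by rewrite !mxE eq_sym => /negPf->; rewrite mulr0.
rewrite !mxE !eqxx !mulr1.
have [<-{t'}|tt'] := eqVneq t t'.
  have := enum_valP t; rewrite /W; case: (enum_val t) => i j /= ij.
  by rewrite connect0 (negPf (forest_bridge S_forest ij)) oppr0 addr0.
(* The edge t' survives the deletion of t, so its endpoints lie in the same component and their
   contributions cancel. *)
apply/eqP; rewrite subr_eq0 /W; set e := bip_graph _; set x := inl (_ t).1.
have e_sym : connect_sym e by apply: sym_connect_sym => -[?|?] [?|?].
have e_edge : e (inl (enum_val t').1) (inr (enum_val t').2).
  rewrite /e /= !inE -surjective_pairing enum_valP andbT.
  by rewrite (inj_eq enum_val_inj) eq_sym.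
by rewrite -(same_connect_r e_sym (connect1 e_edge)).
Qed.

End BipartiteGraph.

Lemma lawrence_linv (m n : nat) (A : 'M[int]_(m, n)) (L : 'M[int]_(n, m)) :
    L *m A = 1%:M ->
  row_mx (block_mx L 0 0 L) 0 *m lawrence A = 1%:M.
Proof.
move=> LA; rewrite /lawrence mul_row_col mul0mx addr0 mulmx_block.
by rewrite !mulmx0 !mul0mx !addr0 !add0r LA -scalar_mx_block.
Qed.

(** * Polynomials restricted to lines and expanded at a point *)

Lemma poly_infinite_roots_eq0 (K : idomainType) (p : {poly K}) (x : nat -> K) :
  injective x -> (forall n, p.[x n] = 0) -> p = 0.
Proof.
move=> x_inj px0; apply: (@roots_geq_poly_eq0 _ _ [seq x n | n <- iota 0 (size p)]).
- by apply/allP => _ /mapP[n _ ->]; apply/eqP/px0.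
- by rewrite map_inj_uniq ?iota_uniq.
- by rewrite size_map size_iota.
Qed.

Section MPolyLines.
Variables (n : nat) (K : comNzRingType).
Implicit Types (f : {mpoly K[n]}) (q v : 'I_n -> K).

Lemma mpoly_alg_ind (P : {mpoly K[n]} -> Prop) :
    (forall c, P c%:MP) -> (forall i, P 'X_i) ->
    (forall f g, P f -> P g -> P (f + g)) ->
    (forall f g, P f -> P g -> P (f * g)) ->
  forall f, P f.
Proof.
move=> PC PX PD PM f; rewrite (mpolyE f).
apply: (big_ind P) => [|//|m _]; first by rewrite -mpolyC0.
rewrite -mul_mpolyC; apply: (PM) => //; rewrite mpolyXE_id.
apply: (big_ind P) => [|//|i _]; first by rewrite -mpolyC1.
by elim: (m i) => [|k IHk]; [rewrite expr0 -mpolyC1 | rewrite exprS; apply: PM].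
Qed.

Lemma mderivXU i j : ('X_i : {mpoly K[n]})^`M(j) = (i == j)%:R.
Proof.
rewrite mderivX mnm1E; have [<-|_] := eqVneq i j; last by rewrite scale0r.
rewrite scale1r (_ : (U_(i) - U_(i))%MM = 0%MM) ?mpolyX0 //.
by apply/mnmP => k; rewrite mnmBE subnn mnm0E.
Qed.

(** The restriction of [f] to the line q + t v, as a polynomial in t: its vanishing can be tested at
    infinitely many t, and its derivative at 0 is a directional derivative. *)
Definition line_poly q v f : {poly K} :=
  mmap (@polyC K) (fun i => (q i)%:P + v i *: 'X) f.

Lemma horner_line_poly q v f t :
  (line_poly q v f).[t] = f.@[fun i => q i + v i * t].
Proof.
rewrite /line_poly; elim/mpoly_alg_ind: f => [c|i|f g IHf IHg|f g IHf IHg].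
- by rewrite mmapC mevalC hornerC.
- by rewrite mmapX mmap1U mevalXU !hornerE.
- by rewrite mmapD hornerD mevalD IHf IHg.
- by rewrite rmorphM hornerM mevalM IHf IHg.
Qed.

Lemma deriv_line_poly q v f :
  (line_poly q v f)^`().[0] = \sum_i v i * (f^`M(i)).@[q].
Proof.
have at0 g : (line_poly q v g).[0] = g.@[q].
  by rewrite horner_line_poly; apply: meval_eq => i; rewrite mulr0 addr0.
rewrite /line_poly; elim/mpoly_alg_ind: f => [c|i|f g IHf IHg|f g IHf IHg].
- rewrite mmapC derivC horner0 big1 // => i _.
  by rewrite mderivC meval0 mulr0.
- rewrite mmapX mmap1U derivD derivC derivZ derivX !hornerE.
  rewrite (bigD1 i) //= big1 ?addr0 => [|j ji].
    by rewrite mderivXU eqxx meval1 mulr1.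
  by rewrite mderivXU eq_sym (negPf ji) meval0 mulr0.
- rewrite mmapD derivD hornerD IHf IHg -big_split.
  by apply: eq_bigr => i _; rewrite mderivD mevalD mulrDr.
- rewrite rmorphM derivM hornerD !hornerM IHf IHg -/(line_poly _ _ _) !at0.
  rewrite mulr_suml mulr_sumr -big_split; apply: eq_bigr => i _ /=.
  rewrite mderivM mevalD !mevalM mulrDr !mulrA; congr (_ + _).
  by congr (_ * _); rewrite mulrC.
Qed.

(** This shows that the polynomials vanishing at q form the ideal generated by the ['X_i - q_i]. *)
Lemma sub_meval_decomp q f :
  exists h : 'I_n -> {mpoly K[n]},
    f - (f.@[q])%:MP = \sum_i ('X_i - (q i)%:MP) * h i.
Proof.
elim/mpoly_alg_ind: f => [c|i|f g [hf Ef] [hg Eg]|f g [hf Ef] [hg Eg]].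
- by exists (fun=> 0); rewrite mevalC subrr big1 // => i _; rewrite mulr0.
- exists (fun j => (j == i)%:R); rewrite mevalXU (bigD1 i) //= eqxx mulr1.
  by rewrite big1 ?addr0 // => j /negPf->; rewrite mulr0.
- exists (fun i => hf i + hg i).
  under eq_bigr do rewrite mulrDr.
  by rewrite big_split /= -Ef -Eg mevalD mpolyCD opprD addrACA.
(* From f g - f(q) g(q) = (f - f(q)) g + f(q) (g - g(q)). *)
- exists (fun i => hf i * g + (f.@[q])%:MP * hg i).
  under eq_bigr do rewrite mulrDr mulrA mulrCA.
  rewrite big_split /= -mulr_suml -mulr_sumr -Ef -Eg mevalM mpolyCM.
  by rewrite mulrBl mulrBr addrA subrK.
Qed.

End MPolyLines.

(** * Likelihood geometry of the simplex *)

Section Simplex.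
Variables (R : realType) (N : nat).
Local Notation C := R[i].
Implicit Types (X : 'rV[C]_N -> Prop) (p q u v : 'rV[C]_N) (f : {mpoly C[N]}).

(* A complex point of the hyperplane is c + x + 'i y, with c the barycentre of
   the simplex and x, y real directions of sum 0; a polynomial vanishing at
   c + s x + t y for all small real s, t vanishes for all complex s, t. *)
Lemma simplex_zariski_dense (Y : 'rV[R]_N -> Prop) p :
    (forall y : 'rV[R]_N, (forall s, 0 < y 0 s) -> \sum_s y 0 s = 1 -> Y y) ->
    \sum_s p 0 s = 1 ->
  zariski_closure (complex_points Y) p.
Proof.
move=> Ysimplex p1 f f0.
have N_gt0 : (0 < N)%N.
  case: N p {f f0 Ysimplex} p1 => // p; rewrite big_ord0 => /esym/eqP.
  by rewrite oner_eq0.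
have NR : (N%:R : R) != 0 by rewrite pnatr_eq0 -lt0n.
pose x s := complex.Re (p 0 s) - N%:R^-1.
pose y s := complex.Im (p 0 s).
have pE s : p 0 s = (N%:R^-1 + x s)%:C + (y s)%:C * 'i.
  rewrite /x [N%:R^-1 + _]addrC subrK.
  by rewrite [LHS]complexE [_ * 'i]mulrC.
have const1 : \sum_(s < N) (N%:R^-1 : R) = 1.
  by rewrite sumr_const card_ord -[RHS](divff NR) [RHS]mulr_natl.
have sum_x : \sum_s x s = 0.
  rewrite big_split sumrN const1 /=.
  have -> : \sum_s complex.Re (p 0 s) = complex.Re (\sum_s p 0 s).
    by rewrite raddf_sum.
  by rewrite p1 subrr.
have sum_y : \sum_s y s = 0.
  have -> : \sum_s y s = complex.Im (\sum_s p 0 s) by rewrite raddf_sum.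
  by rewrite p1.
(* [K] exceeds N B, so each [e j] is below 1 / (N B) when B > 0, and all the real points [r j l]
   keep positive coordinates. *)
pose B := \sum_s (`|x s| + `|y s|).
pose K := Num.bound (N%:R * B).
pose e j : R := (K + j).+1%:R^-1.
have e_inj : injective (fun j => (e j)%:C).
  move=> j j' [/invr_inj/eqP].
  by rewrite eqr_nat eqSS eqn_add2l => /eqP.
have e_gt0 j : 0 < e j by rewrite invr_gt0 ltr0n.
have B_ge0 : 0 <= B by apply: sumr_ge0 => s _; rewrite addr_ge0.
have Be0 : B * e 0 < N%:R^-1.
  rewrite -(ltr_pM2l (_ : 0 < N%:R :> R)) ?ltr0n // divff // mulrA.
  rewrite ltr_pdivrMr ?ltr0n // mul1r addn0.
  apply: (lt_trans (archi_boundP _)); first by rewrite mulr_ge0 ?ler0n.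
  by rewrite ltr_nat.
have e_small j (z : R) : - (`|z| * e 0) <= z * e j.
  rewrite lerNl -mulNr; apply: le_trans (_ : `|z| * e j <= _).
    by rewrite ler_wpM2r ?(ltW (e_gt0 _)) // -normrN ler_norm.
  by rewrite ler_wpM2l // lef_pV2 ?posrE ?ltr0n // ler_nat ltnS leq_add2l.
pose r j l : 'rV[R]_N := \row_s (N%:R^-1 + x s * e j + y s * e l).
have Yr j l : Y (r j l).
  apply: Ysimplex => [s|].
    rewrite mxE -addrA -ltrBlDl sub0r.
    apply: lt_le_trans (lerD (e_small j (x s)) (e_small l (y s))).
    rewrite -opprD -mulrDl ltrN2; apply: le_lt_trans Be0.
    rewrite ler_wpM2r ?(ltW (e_gt0 _)) // /B (bigD1 s) //= lerDl.
    by apply: sumr_ge0 => t _; rewrite addr_ge0.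
  under eq_bigr do rewrite mxE.
  by rewrite !big_split /= -!mulr_suml sum_x sum_y !mul0r !addr0.
have f_r j l : f.@[map_mx (real_complex R) (r j l) 0] = 0.
  by apply: f0; exists (r j l).
(* One parameter at a time: infinitely many roots [e l] allow t = 'i, then infinitely many roots
   [e j] allow s = 1, which gives p. *)
have f_ri j : f.@[fun s => (N%:R^-1 + x s * e j)%:C + (y s)%:C * 'i] = 0.
  rewrite -horner_line_poly (_ : line_poly _ _ _ = 0) ?horner0 //.
  apply: (poly_infinite_roots_eq0 e_inj) => l.
  rewrite horner_line_poly -[RHS](f_r j l); apply: meval_eq => s.
  by rewrite !mxE [RHS]rmorphD [in RHS]rmorphM.
have : f.@[fun s => (N%:R^-1%:C + (y s)%:C * 'i) + (x s)%:C * 1] = 0.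
  rewrite -horner_line_poly (_ : line_poly _ _ _ = 0) ?horner0 //.
  apply: (poly_infinite_roots_eq0 e_inj) => j.
  rewrite horner_line_poly -[RHS](f_ri j); apply: meval_eq => s.
  by rewrite addrAC -rmorphM -rmorphD.
move=> fp; rewrite -[RHS]fp; apply: meval_eq => s.
by rewrite mulr1 pE addrAC -rmorphD.
Qed.

Variable X : 'rV[C]_N -> Prop.
Hypothesis XE : forall p, X p <-> \sum_s p 0 s = 1 /\ forall s, p 0 s != 0.

(* If v has sum 0, a polynomial vanishing on X vanishes at all but finitely
   many points of the line through p in the direction v. *)
Lemma tangent_vector_sum0 p v :
  X p -> (tangent_vector X p v <-> \sum_s v 0 s = 0).
Proof.
move=> Xp; split=> [/(_ (\sum_s 'X_s - 1)) tv|v0 f f0].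
  rewrite -[RHS]tv; last first.
    move=> q /XE[q1 _]; rewrite mevalB meval1 (raddf_sum (meval _)) /= -q1.
    by rewrite (eq_bigr _ (fun s _ => mevalXU _ _)) subrr.
  apply: eq_bigr => s _; rewrite mderivB (raddf_sum (mderiv s)) /=.
  rewrite -mpolyC1 mderivC subr0 (bigD1 s) //= big1 => [|t ts].
    by rewrite mderivXU eqxx addr0 meval1 mulr1.
  by rewrite mderivXU (negPf ts).
have [p1 pn0] := (XE p).1 Xp.
rewrite -deriv_line_poly.
suff -> : line_poly (p 0) (v 0) f = 0 by rewrite deriv0 horner0.
(* [Q] is the product of the coordinates along the line, nonzero at p. At each integer, either [Q]
   vanishes or the point is in [X] and [f] vanishes. *)
pose Q := \prod_s ((p 0 s)%:P + v 0 s *: 'X).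
have Qt t : Q.[t] = \prod_s (p 0 s + v 0 s * t).
  by rewrite horner_prod; apply: eq_bigr => s _; rewrite !hornerE.
have Qn0 : Q != 0.
  apply/prodf_neq0 => s _; apply: contra_neq (pn0 s) => /(congr1 (horner^~ 0)).
  by rewrite !hornerE.
apply/(mulIf Qn0); rewrite mul0r.
apply: (@poly_infinite_roots_eq0 _ _ (fun n => n%:R)) => [m n /eqP|n].
  by rewrite eqr_nat => /eqP.
rewrite hornerM horner_line_poly Qt.
have [[s /eqP s0]|nz] := altP (@existsP _ (fun s => p 0 s + v 0 s * n%:R == 0)).
  by rewrite [X in _ * X](bigD1 s) //= s0 mul0r mulr0.
rewrite (_ : f.@[_] = 0) ?mul0r //.
pose q : 'rV[C]_N := \row_s (p 0 s + v 0 s * n%:R).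
rewrite -(f0 q); first by apply: meval_eq => s; rewrite mxE.
apply/XE; split=> [|s].
  under eq_bigr do rewrite mxE.
  by rewrite big_split /= -mulr_suml v0 mul0r addr0.
by rewrite mxE; apply: contra nz => s0; apply/existsP; exists s.
Qed.

Lemma critical_point_simplex u p :
    \sum_s u 0 s != 0 -> (forall s, u 0 s != 0) ->
  critical_point X u p <-> p = (\sum_s u 0 s)^-1 *: u.
Proof.
move=> U0 u0; split=> [[Xp crit]|->].
  have [p1 pn0] := (XE p).1 Xp.
  apply/rowP => i; rewrite mxE; apply: (mulfI U0); rewrite mulVKf //.
  (* On this tangent vector the likelihood equation reads u_i - u_+ p_i = 0. *)
  have := crit (\row_s (p 0 s * ((s == i)%:R - p 0 i))).
  have E1 : \sum_s (\row_s (p 0 s * ((s == i)%:R - p 0 i))) 0 s = 0.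
    under eq_bigr do rewrite mxE mulrBr.
    rewrite sumrB -mulr_suml p1 mul1r (bigD1 i) //= eqxx mulr1 big1 ?addr0 ?subrr//.
    by move=> s /negPf->; rewrite mulr0.
  move=> /(_ (iffRL (tangent_vector_sum0 _ Xp) E1)).
  under eq_bigr do rewrite mxE mulrA divfK // mulrBr.
  rewrite sumrB -mulr_suml (bigD1 i) //= eqxx mulr1 big1 ?addr0.
    by move/eqP; rewrite subr_eq0 => /eqP.
  by move=> s /negPf->; rewrite mulr0.
have Xp : X ((\sum_s u 0 s)^-1 *: u).
  apply/XE; split=> [|s]; last by rewrite mxE mulf_neq0 ?invr_eq0.
  by under eq_bigr do rewrite mxE; rewrite -mulr_sumr mulVf.
split=> // v /(tangent_vector_sum0 _ Xp) v0.
under eq_bigr do rewrite mxE invfM invrK mulrCA divff // mulr1.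
by rewrite -mulr_sumr v0 mulr0.
Qed.

Lemma multiplicity_simplex u p :
    \sum_s u 0 s != 0 -> critical_point X u p ->
    p = (\sum_s u 0 s)^-1 *: u ->
  multiplicity X u p 1.
Proof.
set U := \sum_s u 0 s => U0 [Xp crit] pE; have [p1 pn0] := (XE p).1 Xp.
have P0 : (\prod_s 'X_s : {mpoly C[N]}).@[p 0] != 0.
  rewrite rmorph_prod /=; apply/prodf_neq0 => s _; rewrite mevalXU.
  exact: pn0.
(* Once the local ideal is the maximal ideal of p, evaluation at p identifies the quotient with the
   constants, with basis 1. *)
suff local_idealE f : local_ideal (critical_ideal X u) p f <-> f.@[p 0] = 0.
  exists (fun=> 1) => f; exists (const_mx f.@[p 0]); split=> [|c].
    apply/local_idealE; rewrite big_ord1 mxE mevalB mevalZ meval1 mulr1.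
    exact: subrr.
  move/local_idealE; rewrite big_ord1 mevalB mevalZ meval1 mulr1.
  by move=> /eqP; rewrite subr_eq0 => /eqP fc; apply/rowP => i; rewrite ord1 mxE.
split=> [[g gp [D tD]] /(_ p Xp) /eqP|fp0].
  rewrite mevalB subr_eq0 mevalM => /eqP gf; apply: (mulfI gp).
  rewrite mulr0 gf /score rmorph_sum /=.
  (* The value of a tangent field at p is a tangent vector, so its score vanishes at the critical
     point p. *)
  have tv : tangent_vector X p (\row_s (D s).@[p 0]).
    move=> h /tD /(_ p Xp); rewrite rmorph_sum /= => h0.
    by rewrite -[RHS]h0; apply: eq_bigr => s _; rewrite mxE mevalM.
  transitivity ((\prod_s 'X_s : {mpoly C[N]}).@[p 0] *
      \sum_s u 0 s / p 0 s * (\row_s (D s).@[p 0]) 0 s); last by rewrite crit ?mulr0.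
  rewrite mulr_sumr; apply: eq_bigr => s _; rewrite mevalZ mevalM mxE.
  rewrite [X in _ = X.@[_] * _](bigD1 s) //= mevalM mevalXU.
  by rewrite mulrACA [p 0 s * _]mulrC divfK // [_ * (D s).@[_]]mulrC.
have [h fE] := sub_meval_decomp (p 0) f; rewrite fp0 mpolyC0 subr0 in fE.
exists (\prod_s 'X_s) => //.
(* The field below is - u_+^-1 \sum_i h_i x_s (delta_si - x_i). *)
pose H : {mpoly C[N]} := \sum_i 'X_i * h i.
exists (fun s => 'X_s * (U^-1 *: (H - h s))).
  move=> g g0 q Xq; have [q1 _] := (XE q).1 Xq.
  pose v : 'rV[C]_N := \row_s (q 0 s * (U^-1 * (H.@[q 0] - (h s).@[q 0]))).
  have : \sum_s v 0 s = 0.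
    under eq_bigr do rewrite mxE mulrCA mulrBr.
    rewrite -mulr_sumr sumrB -mulr_suml q1 mul1r /H rmorph_sum /=.
    by under eq_bigr do rewrite mevalM mevalXU; rewrite subrr mulr0.
  move=> /(iffRL (tangent_vector_sum0 _ Xq)) /(_ g g0) vg.
  rewrite rmorph_sum /= -[RHS]vg; apply: eq_bigr => s _.
  by rewrite mxE !mevalM mevalXU mevalZ mevalB.
move=> q _; rewrite (_ : _ - _ = 0) ?meval0 //; apply/eqP; rewrite subr_eq0.
apply/eqP; rewrite /score fE.
(* As u_s / u_+ = p_s, the sum is H - sum_s p_s h_s = sum_s (x_s - p_s) h_s, which is f. *)
transitivity ((\prod_s 'X_s) * \sum_s u 0 s *: (U^-1 *: (H - h s))).
  congr (_ * _).
  under [RHS]eq_bigr do rewrite !scalerBr.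
  rewrite sumrB -!scaler_suml -/U scalerA divff // scale1r -sumrB.
  by apply: eq_bigr => s _; rewrite mulrBl pE mxE mul_mpolyC scalerA [u 0 s * _]mulrC.
rewrite mulr_sumr; apply: eq_bigr => s _; rewrite -scalerAr; congr (_ *: _).
by rewrite [in RHS]mulrAC -(bigD1 s (P := xpredT)).
Qed.

End Simplex.

(** * ML-degree of a model with full row span *)

Lemma ML_degree_row_full (R : realType) (m N : nat) (M : 'M[int]_(m, N)) :
    (0 < N)%N -> row_full (map_mx intr M : 'M[R]_(m, N)) -> ML_degree R M 1.
Proof.
move=> N_gt0 M_full; set X := likelihood_variety (R := R) M.
have XE p : X p <-> \sum_s p 0 s = 1 /\ forall s, p 0 s != 0.
  split=> [[]//|[p1 pn0]]; split=> //.
  by apply: simplex_zariski_dense => // y y_gt0 y1; split; rewrite ?submx_full.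
(* Generic data have u_+ and all u_s nonzero; this polynomial takes the value N at the all-ones
   vector. *)
exists ((\sum_s 'X_s) * \prod_s 'X_s).
  suff: ((\sum_s 'X_s) * \prod_s 'X_s : {mpoly R[i][N]}).@[fun=> 1] != 0.
    by apply: contra_neq => ->; rewrite meval0.
  rewrite mevalM rmorph_sum rmorph_prod /=.
  under eq_bigr do rewrite mevalXU.
  under [X in _ * X]eq_bigr do rewrite mevalXU.
  by rewrite prodr_const expr1n mulr1 sumr_const card_ord pnatr_eq0 -lt0n.
move=> u; rewrite mevalM rmorph_sum rmorph_prod /= mulf_eq0 negb_or.
under eq_bigr do rewrite mevalXU.
under [X in _ && (X != 0)]eq_bigr do rewrite mevalXU.
move=> /andP[U0 /prodf_neq0 u0].
have crit p := critical_point_simplex XE p U0 (fun s => u0 s isT).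
exists [:: (\sum_s u 0 s)^-1 *: u], (fun=> 1%N); split=> //.
- by move=> p; rewrite inE; split=> [/eqP/crit|/crit/eqP].
- move=> p; rewrite inE => /eqP pE.
  exact: (multiplicity_simplex XE U0 ((crit p).2 pE) pE).
- by rewrite big_seq1.
Qed.

Theorem mainTheorem7 (R : realType) (a b : nat) (S : {set 'I_a * 'I_b})
    (S_neq0 : S != set0)
    (S_forest : is_forest (bip_graph S))
    (S_not_stars : ~ is_forest_of_stars (bip_graph S)) :
  ML_degree R (lawrence (quasi_indep_mx S)) 1 /\
  ~ cTFP_mx (modified_lawrence (quasi_indep_mx S)).
Proof.
split; last exact: not_cTFP_modified_lawrence.
apply: ML_degree_row_full; first by rewrite addn_gt0 card_gt0 S_neq0.
have [L /lawrence_linv LA] := forest_quasi_indep_mx_linv S_forest.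
apply/row_fullP; exists (map_mx intr (row_mx (block_mx L 0 0 L) 0)).
by rewrite -map_mxM LA map_scalar_mx.
Qed.
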